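(* For any $\theta_1,\theta_2\in\mathbb{R}$, the set $$\Theta(\theta_1,\theta_2):= \left\{ (\xi, \zeta)\in\mathbb{R}^2: \; \limsup_{Q\to\infty}\, Q \min_{q\in \mathbb{Z},\, 0<q\le Q} \Vert q\xi-\theta_1\Vert\cdot \Vert q \zeta-\theta_2\Vert > 0 \right\}$$ contains a dense $G_{\delta}$ subset of $\mathbb{R}^2$.
   Context: $\Vert x\Vert$ denotes the distance from the real number $x$ to the nearest integer. In $\limsup_{Q\to\infty}$ the variable $Q$ runs through the positive integers; the upper limit is taken in $[0,\infty]$. *)

(* Defs.v *)
From mathcomp Require Import all_boot all_order all_algebra.
From mathcomp Require Import all_classical all_reals all_analysis.

Set Implicit Arguments.
Unset Strict Implicit.
Unset Printing Implicit Defensive.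

Import Order.TTheory GRing.Theory Num.Theory.
Import numFieldNormedType.Exports.

Local Open Scope classical_set_scope.
Local Open Scope ring_scope.

Definition dist_int (R : realType) (x : R) : R :=
  inf [set `|x - m%:~R| | m in [set: int]].

(* The neutral element +oo only makes the fold well defined: for 0 < Q this is
   a minimum over a nonempty finite set of reals. *)
Definition min_prod (R : realType) (theta1 theta2 xi zeta : R) (Q : nat)
    : \bar R :=
  \big[Order.min/+oo%E]_(1 <= q < Q.+1)
    (dist_int (q%:R * xi - theta1) * dist_int (q%:R * zeta - theta2))%:E.

(* The sequence index n stands for Q = n.+1, so that Q runs through the
   positive integers. *)
Definition Theta (R : realType) (theta1 theta2 : R) : set (R * R) :=
  [set p | (0 < limn_esup (fun n : nat =>
     (n.+1)%:R%:E * min_prod theta1 theta2 p.1 p.2 n.+1))%E].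

(* Main.v *)
From HB Require Import structures.
Require Import Defs.
From mathcomp Require Import all_boot all_order all_algebra.
From mathcomp Require Import all_classical all_reals all_analysis.
From mathcomp Require Import borel_hierarchy.
From mathcomp Require Import zify ring lra.
Import Order.TTheory GRing.Theory Num.Theory.
Import numFieldNormedType.Exports.

Set Implicit Arguments.
Unset Strict Implicit.
Unset Printing Implicit Defensive.

Local Open Scope classical_set_scope.
Local Open Scope ring_scope.

(** Call [S] a good scale for [(xi, zeta)] and [c] when
    [c < S * ||q xi - theta1|| * ||q zeta - theta2||] for all [0 < q < S].
    This is an open condition on [(xi, zeta)], and a point with arbitrarily
    large good scales for one fixed [c > 0] lies in [Theta] (take [Q = S - 1]).
    By Baire's theorem in [R * R] it is enough to find, for some [c] depending
    on [theta1] and [theta2] only, points with a large good scale near any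
    target: this is [has_dense_scales].  All these points are rational.

    If [6 theta1] and [6 theta2] are not integers
    ([has_dense_scales_nonint]), take
    [zeta = g / r] and [xi = w / (r M)] with [w = g] modulo [r], and
    [S = r M].  Then [M xi = zeta] modulo 1, so that
    [M (q xi - theta1)] and [q zeta - theta2] differ by [M theta1 - theta2]
    modulo 1.  If [||M theta1 - theta2||] is bounded below, the
    two factors cannot be small together: either [||q zeta - theta2||] is
    bounded below, or [||q xi - theta1||] is at least of order [1 / M].  The
    other factor is at least of order [1 / (r M)], respectively [1 / r], as
    soon as [r M theta1] and [r theta2] stay away from the integers
    ([resonant_lower_bound]).  Suitable [r] and [M] exist among any four
    consecutive integers.

    If [theta1 = 0] and [theta2] is not an integer ([has_dense_scales_0l]), the
    same construction works with [M = r], but now [||q xi||] is bounded below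
    because [w] is coprime to [r].

    If [theta1 = theta2 = 0] ([has_dense_scales_00]), take [S = q ^ 2] where
    [B / q] is a convergent of [sqrt 2], and points of denominator [q ^ 2]
    whose multiples run through the lattice of the [(j, t)] with
    [t = (B q + 1) j] modulo [q ^ 2].  The fraction [B / q] is badly
    approximable with a uniform constant, the fraction
    [(B q + 1) / q ^ 2 = B / q + 1 / q ^ 2] inherits this property (its
    continued fraction is obtained from the one of [B / q] by folding), and
    hence [|j| |t|] is at least of order [q ^ 2] on the nonzero part of the
    lattice.  Folding is what gives density: the two base-[q] digits of the
    first numerator can be used to steer [xi] and [zeta] separately.

    Since [||k x|| <= k ||x||], a solution for [(k theta1, k theta2)] gives one
    for [(theta1, theta2)]; with [k = 6], translation by integers and
    exchange of the coordinates, the three cases cover everything. *)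

(** * Badly approximable fractions and their folding *)

Lemma sqr_neq_double_sqr (z j : int) : j != 0 -> z ^+ 2 != 2 * j ^+ 2.
Proof.
move=> j0; apply/eqP => e.
have : (`|z| ^ 2 = 2 * `|j| ^ 2)%N.
  by rewrite -!abszX e abszM.
have j1 : (0 < `|j|)%N by rewrite absz_gt0.
move/(congr1 (fun n => odd (logn 2 n))).
by rewrite lognM ?expn_gt0 ?j1// !lognX oddD !oddM.
Qed.

Lemma half_sqr (q x : int) : 2 * `|x| < q -> 4 * `|x| ^+ 2 <= q ^+ 2.
Proof.
move=> xq; have -> : 4 * `|x| ^+ 2 = (2 * `|x|) ^+ 2 by ring.
by apply: lerXn2r; rewrite ?nnegrE ?mulr_ge0//; lia.
Qed.

(** [B / q] is badly approximable: if [B j - y = q z], then the nonzero integer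
    [z ^ 2 - 2 j ^ 2], multiplied by [q ^ 2], is
    [+- j ^ 2 - 2 B j y + y ^ 2], to which the squares contribute at most
    [q ^ 2 / 2] when [|j|] and [|y|] are below [q / 2]. *)
Lemma pell_lattice (q B j y : int) :
  0 < q -> 0 < B -> B <= 2 * q -> `|B ^+ 2 - 2 * q ^+ 2| = 1 ->
  ~~ (q %| j)%Z -> (q %| B * j - y)%Z -> q <= 8 * (`|j| * `|y|).
Proof.
move=> q0 B0 B2q pell qj /dvdzP[z ez].
have j0 : j != 0 by apply: contraNneq qj => ->; rewrite dvdz0.
(* B is invertible modulo q, with inverse +-B *)
have y0 : y != 0.
  apply: contraNneq qj => y0.
  have [e|e] : B ^+ 2 - 2 * q ^+ 2 = 1 \/ B ^+ 2 - 2 * q ^+ 2 = -1 by lia.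
  - apply/dvdzP; exists (B * z - 2 * q * j).
    by transitivity ((B ^+ 2 - 2 * q ^+ 2) * j); [rewrite e mul1r|nia].
  - apply/dvdzP; exists (2 * q * j - B * z).
    by transitivity (- (B ^+ 2 - 2 * q ^+ 2) * j); [rewrite e opprK mul1r|nia].
have [jl|jl] := leP q (2 * `|j|); first by have : 1 <= `|y|; [lia|nia].
have [yl|yl] := leP q (2 * `|y|); first by have : 1 <= `|j|; [lia|nia].
have /eqP zj := sqr_neq_double_sqr z j0.
have n1 : 1 <= `|z ^+ 2 - 2 * j ^+ 2| by lia.
have eq : q ^+ 2 * (z ^+ 2 - 2 * j ^+ 2) =
    (B ^+ 2 - 2 * q ^+ 2) * j ^+ 2 - 2 * B * (j * y) + y ^+ 2.
  have -> : q ^+ 2 * (z ^+ 2 - 2 * j ^+ 2) = (z * q) ^+ 2 - 2 * q ^+ 2 * j ^+ 2 by ring.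
  by rewrite -ez; ring.
have : q ^+ 2 * 1 <= `|j| ^+ 2 + 2 * B * (`|j| * `|y|) + `|y| ^+ 2.
  apply: le_trans (ler_wpM2l (sqr_ge0 q) n1) _.
  rewrite -[X in X * _](ger0_norm (sqr_ge0 q)) -normrM eq.
  apply: le_trans (ler_normD _ _) _; rewrite normrX lerD2r.
  apply: le_trans (ler_normB _ _) _.
  by rewrite normrM pell mul1r normrX !normrM (gtr0_norm B0).
have : B * (`|j| * `|y|) <= 2 * q * (`|j| * `|y|) by rewrite ler_wpM2r// mulr_ge0.
move: (`|j| * `|y|) => p h1 h2.
have h3 := half_sqr jl; have h4 := half_sqr yl.
rewrite -(ler_pM2l q0); move: h1 h2 h3 h4.
by move: (`|j| ^+ 2) (`|y| ^+ 2); clear; lia.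
Qed.

(** Folding preserves bad approximability.  The pair [(t, y)] satisfies the same
    congruence as [(j, y)], since [t = j] modulo [q]; as [q y = t - j], one of
    [j] and [t] is at least [q |y| / 2], and [pell_lattice] applies to the
    other one. *)
Lemma fold_lattice (q B j t y : int) :
  0 < q -> 0 < B -> B <= 2 * q -> `|B ^+ 2 - 2 * q ^+ 2| = 1 ->
  ~~ (q %| j)%Z -> (q %| B * j - y)%Z -> t = j + q * y ->
  q ^+ 2 <= 16 * (`|j| * `|t|).
Proof.
move=> q0 B0 B2q pell qj By et.
have hj := pell_lattice q0 B0 B2q pell qj By.
have qt : ~~ (q %| t)%Z by rewrite et rpredDr ?dvdz_mulr.
have ht : q <= 8 * (`|t| * `|y|).
  apply: (pell_lattice q0 B0 B2q pell qt).
  have -> : B * t - y = (B * j - y) + q * (B * y) by rewrite et; ring.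
  by rewrite rpredDr ?dvdz_mulr.
have y0 : 1 <= `|y|.
  rewrite -gtz0_ge1 normr_gt0; apply/eqP => y0.
  by move: hj; rewrite y0 normr0 !mulr0 leNgt q0.
have tri : q * `|y| <= `|j| + `|t|.
  rewrite -{1}(gtr0_norm q0) -normrM.
  have -> : q * y = t - j by rewrite et addrC addKr.
  by rewrite [leRHS]addrC ler_normB.
move: hj ht tri y0 (normr_ge0 j) (normr_ge0 t).
move: `|j| `|t| `|y| => J T Y hj ht tri y0 J0 T0; clear -q0 hj ht tri J0 T0.
have [c|c] := leP (q * Y) (2 * T).
  have : q * Y * J <= 2 * T * J by rewrite ler_wpM2r.
  have : q * q <= q * (8 * (J * Y)) by rewrite ler_wpM2l // ltW.
  lia.
have c' : q * Y <= 2 * J by lia.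
have : q * Y * T <= 2 * J * T by rewrite ler_wpM2r.
have : q * q <= q * (8 * (T * Y)) by rewrite ler_wpM2l // ltW.
lia.
Qed.

(** To be used with [m1] and [m2] the integers nearest to the multiples by [a] of
    the two fractions of denominator [q ^ 2].  When [q] divides [j] it also
    divides [t], and [q ^ 2 <= |j| |t|] holds because neither of them is 0. *)
Lemma folded_lattice_bound (q B s1 s2 v a m1 m2 : int) :
  0 < q -> 0 < B -> B <= 2 * q -> `|B ^+ 2 - 2 * q ^+ 2| = 1 ->
  coprimez s1 q -> (q %| B * s1 - v)%Z -> 0 < a < q ^+ 2 ->
  q ^+ 2 <= 16 * (`|a * (q * s2 + s1) - q ^+ 2 * m1| *
                  `|a * (q * (v + s2) + s1) - q ^+ 2 * m2|).
Proof.
move=> q0 B0 B2q pell s1q qv /andP[a0 aq].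
set j := a * _ - _; set t := _ - q ^+ 2 * m2.
set y := a * v - q * (m2 - m1).
have et : t = j + q * y by rewrite /t /j /y; ring.
have cop k : coprimez (q * k + s1) (q ^+ 2).
  by apply: coprimezXr; rewrite /coprimez gcdzC mulrC gcdzMDl gcdzC.
have nz k m : a * (q * k + s1) - q ^+ 2 * m != 0.
  apply/eqP => e.
  have : (q ^+ 2 %| a * (q * k + s1))%Z.
    by apply/dvdzP; exists m; move: e; lia.
  rewrite Gauss_dvdzl; last by rewrite coprimez_sym.
  have qq : 0 < q ^+ 2 by rewrite exprn_gt0.
  move=> /dvdzP[l el]; have l0 : 0 < l by rewrite -(pmulr_lgt0 _ qq) -el.
  by move: aq; rewrite ltNge el ler_peMl ?(ltW qq)// -gtz0_ge1.
have [/dvdzP[j' ej]|qj] := boolP (q %| j)%Z.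
  have qa : (q %| a)%Z.
    rewrite -(@Gauss_dvdzl _ _ s1); last by rewrite coprimez_sym.
    apply/dvdzP; exists (j' - a * s2 + q * m1).
    by move: ej; rewrite /j => ej; have := ej; lia.
  have /dvdzP[t' et'] : (q %| t)%Z.
    by rewrite et rpredD//; [apply/dvdzP; exists j'|rewrite dvdz_mulr].
  have : j != 0 by apply: nz.
  have : t != 0 by apply: nz.
  rewrite ej et' !normrM (gtr0_norm q0) => t0 j0.
  have : 1 <= `|j'| by move: j0; rewrite mulf_eq0; lia.
  have : 1 <= `|t'| by move: t0; rewrite mulf_eq0; lia.
  move: `|j'| `|t'| => J T J1 T1.
  have JT1 : 1 <= J * T by rewrite mulr_ege1.
  have -> : 16 * (J * q * (T * q)) = 16 * (J * T) * q ^+ 2 by ring.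
  by rewrite ler_peMl ?exprn_ge0 ?(ltW q0)//; clear -JT1; lia.
apply: (fold_lattice q0 B0 B2q pell qj _ et).
have -> : B * j - y = (B * s1 - v) * a + q * (B * (a * s2 - q * m1) + (m2 - m1)).
  by rewrite /j /y; ring.
by rewrite rpredD// ?dvdz_mulr.
Qed.

(** * Pell convergents in residue classes *)

(** Over [nat] this produces the solutions [(q, B)] of
    [B ^ 2 - 2 q ^ 2 = +- 1]; it is polymorphic in order to be run in ['Z_X]
    too. *)
Definition pell_step (A : nmodType) (x : A * A) : A * A :=
  (x.1 + x.2, x.1 *+ 2 + x.2).

Lemma pell_step_inj (A : zmodType) : injective (@pell_step A).
Proof.
move=> [a b] [c d] [/= e1 e2].
have ac : a = c.
  by apply: (addIr (a + b)); rewrite {2}e1 !addrA -!mulr2n e2.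
by move: e1; rewrite ac => /addrI ->.
Qed.

Definition pell n : nat * nat := iter n (@pell_step nat) (1, 1)%N.

Lemma pell_step_nat (a b : nat) : pell_step (a, b) = (a + b, a + a + b)%N.
Proof. by []. Qed.

Lemma pell_norm n :
  `|(pell n).2%:Z ^+ 2 - 2 * (pell n).1%:Z ^+ 2| = 1.
Proof.
elim: n => // n ih; rewrite -[RHS]ih /pell iterS -/(pell n).
case: (pell n) => a b; rewrite pell_step_nat -normrN /=; congr `|_|.
rewrite !PoszD. by ring.
Qed.

Lemma pell_bounds n :
  [&& n < (pell n).1, 0 < (pell n).2 & (pell n).2 <= 2 * (pell n).1]%N.
Proof.
elim: n => // n; rewrite /pell iterS -/(pell n).
by case: (pell n) => a b; rewrite pell_step_nat /=; lia.
Qed.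

(** Modulo [X] the recurrence is a permutation of a finite set, hence it comes
    back to its initial value [(1, 1)] infinitely often. *)
Lemma pell_mod X n : (1 < X)%N ->
  exists2 m, (n <= m)%N & (pell m).1 = 1 %[mod X].
Proof.
move=> X1.
pose f : 'Z_X * 'Z_X -> 'Z_X * 'Z_X := @pell_step _.
have fE m : iter m f (1, 1) = ((pell m).1%:R, (pell m).2%:R).
  elim: m => // m ih; rewrite !iterS ih /pell iterS -/(pell m).
  by case: (pell m) => a b; rewrite pell_step_nat /f /pell_step /= !natrD mulr2n.
pose k := order f (1, 1).
have per m : iter (m * k) f (1, 1) = (1, 1).
  elim: m => // m ih; rewrite mulSn iterD ih; apply: iter_order.
  exact: pell_step_inj.
exists (n * k)%N; first by rewrite leq_pmulr // order_gt0.
move: (per n); rewrite fE => -[e _].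
have := congr1 val e; rewrite /= !val_Zp_nat //.
by rewrite Zp_cast.
Qed.

(** * Distance to the nearest integer *)

Section DistInt.
Variable R : realType.
Implicit Types (x y : R) (m : int).

Lemma dist_int_le x m : dist_int x <= `|x - m%:~R|.
Proof.
apply: ge_inf; last by exists m.
by exists 0 => _ [k _ <-].
Qed.

Lemma dist_int_ex x : exists m, dist_int x = `|x - m%:~R|.
Proof.
pose m := Num.floor (x + 2^-1); exists m; apply/eqP; rewrite eq_le dist_int_le /=.
apply: lb_le_inf; first by exists `|x - 0%:~R|, 0.
move=> _ [k _ <-].
have h1 : m%:~R <= x + 2^-1 by exact: floor_le_tmp.
have h2 : x + 2^-1 < m%:~R + 1 by have := floorD1_gt (x + 2^-1); rewrite intrD.
have hm : `|x - m%:~R| <= 2^-1 by rewrite ler_norml; lra.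
have [->//|km] := eqVneq k m.
have : 1 <= `|k%:~R - m%:~R| :> R.
  by rewrite -intrB -intr_norm ler1z; lia.
have := ler_distD x k%:~R m%:~R; rewrite (distrC k%:~R x); lra.
Qed.

Lemma dist_int_ge0 x : 0 <= dist_int x.
Proof. by have [m ->] := dist_int_ex x. Qed.

Lemma dist_intN x : dist_int (- x) = dist_int x.
Proof.
wlog: x / dist_int (- x) <= dist_int x.
  move=> h; have [|/ltW] := leP (dist_int (- x)) (dist_int x); first exact: h.
  by rewrite -{1}(opprK x) => /h; rewrite opprK.
move=> le; apply/eqP; rewrite eq_le le /=.
have [m ->] := dist_int_ex (- x); apply: le_trans (dist_int_le x (- m)) _.
by rewrite -opprD normrN rmorphN opprK.
Qed.

Lemma dist_intD x y : dist_int (x + y) <= dist_int x + dist_int y.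
Proof.
have [m ->] := dist_int_ex x; have [k ->] := dist_int_ex y.
apply: le_trans (dist_int_le _ (m + k)) _.
apply: le_trans _ (ler_normD _ _); rewrite le_eqVlt; apply/orP; left; apply/eqP.
by congr `|_|; rewrite intrD; ring.
Qed.

Lemma dist_intB x y : dist_int (x - y) <= dist_int x + dist_int y.
Proof. by rewrite -(dist_intN y) dist_intD. Qed.

Lemma dist_int_int m : dist_int (m%:~R : R) = 0.
Proof.
apply/eqP; rewrite eq_le dist_int_ge0 andbT.
by rewrite (le_trans (dist_int_le _ m))// subrr normr0.
Qed.

Lemma dist_int_addz x m : dist_int (x + m%:~R) = dist_int x.
Proof.
apply/eqP; rewrite eq_le; apply/andP; split.
  by rewrite (le_trans (dist_intD _ _))// dist_int_int addr0.
by rewrite -{1}(addrK m%:~R x) (le_trans (dist_intB _ _))// dist_int_int addr0.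
Qed.

Lemma dist_int_eq0 x : dist_int x = 0 -> exists m, x = m%:~R.
Proof.
have [m ->] := dist_int_ex x => /eqP; rewrite normr_eq0 subr_eq0 => /eqP ->.
by exists m.
Qed.

Lemma dist_int_norm x : dist_int x <= `|x|.
Proof. by have := dist_int_le x 0; rewrite subr0. Qed.

Lemma dist_int_lip x y : `|dist_int x - dist_int y| <= `|x - y|.
Proof.
rewrite ler_norml; apply/andP; split.
  rewrite lerNl opprB lerBlDr distrC.
  have := dist_intD (y - x) x; rewrite subrK => h.
  by rewrite (le_trans h)// lerD2r dist_int_norm.
rewrite lerBlDr.
have := dist_intD (x - y) y; rewrite subrK => h.
by rewrite (le_trans h)// lerD2r dist_int_norm.
Qed.

Lemma dist_int_natl n x : dist_int (n%:R * x) <= n%:R * dist_int x.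
Proof.
have [m ->] := dist_int_ex x.
apply: le_trans (dist_int_le _ (n%:Z * m)) _.
rewrite -[X in X * `|_|](ger0_norm (ler0n R n)) -normrM intrM mulrBr.
by rewrite -pmulrn.
Qed.

Lemma dist_int_small n m : (0 < n)%N -> ~~ (n %| m)%Z ->
  n%:R^-1 <= dist_int (m%:~R / n%:R : R).
Proof.
move=> n0 nm; have n0' : (0 : R) < n%:R by rewrite ltr0n.
have [k ->] := dist_int_ex (m%:~R / n%:R : R).
have -> : m%:~R / n%:R - k%:~R = (m - k * n%:Z)%:~R / n%:R :> R.
  by rewrite intrB intrM -pmulrn; field; rewrite gt_eqF.
rewrite normrM normfV (gtr0_norm n0') ler_pdivlMr // mulVf ?gt_eqF//.
rewrite -intr_norm ler1z.
suff : m - k * n%:Z != 0 by lia.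
by apply: contraNneq nm => /subr0_eq ->; rewrite dvdz_mull.
Qed.

End DistInt.

(** * Reduced fractions near a target *)

(** Density of the reduced fractions of denominator [r].  Sieving is avoided by
    taking [r = 1] modulo [K * K!]: each [i <= K] divides [r - 1], so
    that the numerators [n r + i K! j], which are near [(n + i / K) r], are
    coprime to [r]. *)
Lemma coprime_residue_near (R : realType) (K j : nat) (x : R) :
  (0 < K)%N -> (0 < j)%N ->
  exists2 g : int, coprimez g (1 + K * K`! * j)%N &
    `|g%:~R / (1 + K * K`! * j)%:R - x| <= K%:R^-1.
Proof.
move=> K0 j0; set r := (1 + _)%N.
have Kr : (K <= r)%N.
  by rewrite /r -mulnA ltnW// ltnS leq_pmulr// muln_gt0 fact_gt0.
have Kp : (0 : R) < K%:R by rewrite ltr0n.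
have rp : (0 : R) < r%:R by rewrite ltr0n.
have KR : (K%:R : R) <= r%:R by rewrite ler_nat.
pose m := Num.floor (K%:R * x); pose n := (m %/ K%:Z)%Z.
have [i [iK mE]] : exists i : nat, (i < K)%N /\ m = n * K%:Z + i%:Z.
  have K0' : K%:Z != 0 by lia.
  exists `|(m %% K%:Z)%Z|%N; have := modz_ge0 m K0'; have := ltz_mod m K0'.
  by rewrite {3}(divz_eq m K%:Z) -/n => h1 h2; split; lia.
exists (n * r%:Z + (i.+1 * K`! * j)%N%:Z).
  rewrite /coprimez gcdzC gcdzMDl gcdzC -/(coprimez _ _) coprimezE !absz_nat.
  have cop t : (t %| K * K`! * j)%N -> coprime t r.
    by move=> tr; apply: coprime_dvdl tr (coprimenS _).
  have Kfr : (K`! %| K * K`! * j)%N by rewrite dvdn_mulr// dvdn_mull.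
  have ir : (i.+1 %| K * K`! * j)%N by rewrite (dvdn_trans _ Kfr)// dvdn_fact.
  by rewrite !coprimeMl (cop _ ir) (cop _ Kfr) cop// dvdn_mull.
have h1 : m%:~R <= K%:R * x by exact: floor_le_tmp.
have h2 : K%:R * x < m%:~R + 1 by have := floorD1_gt (K%:R * x); rewrite intrD.
have eK : K%:R * (n%:~R * r%:R + (i.+1 * K`! * j)%:R) =
    (m%:~R + 1) * r%:R - i.+1%:R :> R.
  rewrite mE intrD intrM -!pmulrn /r !natrD !natrM -(natr1 i); ring.
have iK' : (i.+1%:R : R) <= K%:R by rewrite ler_nat.
rewrite intrD intrM -!pmulrn.
rewrite -(ler_pM2l Kp) -[X in X * `|_|](gtr0_norm Kp) -normrM mulrBr mulrA eK.
rewrite divff ?gt_eqF// mulrBl mulfK ?gt_eqF//.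
have i1 : 0 <= i.+1%:R / r%:R :> R by rewrite divr_ge0.
have i2 : i.+1%:R / r%:R <= 1 :> R by rewrite ler_pdivrMr// mul1r (le_trans iK').
by rewrite ler_norml; apply/andP; split; lra.
Qed.

(** * Dense scales and their symmetries *)

(** The constant [c] is chosen before the target [(x, y)]: Baire's theorem
    requires one [c] for all open sets.  The range is [q < S] and not [q <= S]
    because at [q = S], the common denominator of the fractions constructed
    below, the product can vanish. *)
Definition has_dense_scales (R : realType) (theta1 theta2 : R) : Prop :=
  exists2 c : R, 0 < c &
  forall (x y e : R) (N : nat), 0 < e ->
  exists xi zeta : R, exists S : nat,
    [/\ `|xi - x| < e, `|zeta - y| < e, (N < S)%N &
        forall q : nat, (0 < q < S)%N ->
          c <= S%:R * (dist_int (q%:R * xi - theta1) *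
                       dist_int (q%:R * zeta - theta2))].

Section Reductions.
Variable R : realType.
Implicit Types t : R.

Lemma has_dense_scales_sym t1 t2 : has_dense_scales t1 t2 -> has_dense_scales t2 t1.
Proof.
case=> c c0 h; exists c => // x y e N e0.
have [zeta [xi [S [h1 h2 h3 h4]]]] := h y x e N e0.
by exists xi, zeta, S; split => // q /h4; rewrite (mulrC (dist_int _)).
Qed.

Lemma has_dense_scales_natl (k : nat) t1 t2 : (0 < k)%N ->
  has_dense_scales (k%:R * t1) (k%:R * t2) -> has_dense_scales t1 t2.
Proof.
move=> k0 [c c0 h].
have kp : (0 : R) < k%:R by rewrite ltr0n.
have k2 : (0 : R) < k%:R * k%:R by rewrite mulr_gt0.
exists (c / (k%:R * k%:R)); first by rewrite divr_gt0.
move=> x y e N e0.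
have [xi [zeta [S [h1 h2 h3 h4]]]] :=
  h (k%:R * x) (k%:R * y) (k%:R * e) N (mulr_gt0 kp e0).
exists (xi / k%:R), (zeta / k%:R), S.
have near u v : `|u - k%:R * v| < k%:R * e -> `|u / k%:R - v| < e.
  move=> uv; rewrite -(ltr_pM2l kp) -[X in X * `|_|](gtr0_norm kp) -normrM.
  by rewrite mulrBr mulrCA divff ?gt_eqF// mulr1.
split; [exact: near|exact: near|by []|].
move=> q /h4 hq; rewrite ler_pdivrMr// (le_trans hq)// -!mulrA ler_wpM2l//.
have scale u t : dist_int (q%:R * u - k%:R * t) <=
    k%:R * dist_int (q%:R * (u / k%:R) - t).
  have -> : q%:R * u - k%:R * t = k%:R * (q%:R * (u / k%:R) - t).
    by field; rewrite gt_eqF.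
  exact: dist_int_natl.
have := ler_pM (dist_int_ge0 _) (dist_int_ge0 _) (scale xi t1) (scale zeta t2).
by move=> /le_trans; apply; rewrite le_eqVlt; apply/orP; left; apply/eqP; ring.
Qed.

Lemma has_dense_scales_int (m : int) t2 :
  has_dense_scales 0 t2 -> has_dense_scales m%:~R t2.
Proof.
case=> c c0 h; exists c => // x y e N e0.
have [xi [zeta [S [h1 h2 h3 h4]]]] := h x y e N e0.
exists xi, zeta, S; split => // q /h4.
have -> : q%:R * xi - m%:~R = q%:R * xi + (- m)%:~R by rewrite rmorphN.
by rewrite subr0 dist_int_addz.
Qed.
End Reductions.

(** * Resonant points *)

(** The relation [M xi = zeta] modulo 1 gives
    [||M theta1 - theta2|| <= ||q zeta - theta2|| + M ||q xi - theta1||], so one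
    of the two terms on the right is at least [c / 2]. *)
Lemma resonant_lower_bound (R : realType) (theta1 theta2 xi zeta c : R)
    (r M : nat) (k : int) :
  (0 < r)%N -> (0 < M)%N -> 0 < c ->
  M%:R * xi = zeta + k%:~R ->
  c <= dist_int (M%:R * theta1 - theta2) ->
  (forall q : nat, (0 < q < r * M)%N ->
     c / (r * M)%:R <= dist_int (q%:R * xi - theta1) /\
     c / r%:R <= dist_int (q%:R * zeta - theta2)) ->
  forall q : nat, (0 < q < r * M)%N ->
    c ^+ 2 / 2 <= (r * M)%:R *
      (dist_int (q%:R * xi - theta1) * dist_int (q%:R * zeta - theta2)).
Proof.
move=> r0 M0 c0 xz hM hq q /hq[].
set A := dist_int (q%:R * xi - _); set B := dist_int (_ * zeta - _) => hA hB.
have rp : (0 : R) < r%:R by rewrite ltr0n.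
have Mp : (0 : R) < M%:R by rewrite ltr0n.
have A0 : 0 <= A := dist_int_ge0 _.
have B0 : 0 <= B := dist_int_ge0 _.
have tri : dist_int (M%:R * theta1 - theta2) <= B + M%:R * A.
  have -> : M%:R * theta1 - theta2 =
      (q%:R * zeta - theta2) - M%:R * (q%:R * xi - theta1) + (q%:Z * k)%:~R.
    by rewrite intrM -pmulrn mulrBr [M%:R * (_ * xi)]mulrCA xz; ring.
  rewrite dist_int_addz (le_trans (dist_intB _ _))// lerD2l.
  exact: dist_int_natl.
have {}hA : c <= A * (r%:R * M%:R) by move: hA; rewrite natrM ler_pdivrMr ?mulr_gt0.
have {}hB : c <= B * r%:R by rewrite -ler_pdivrMr.
rewrite natrM.
have [le|lt] := leP (c / 2) (M%:R * A).
  have -> : c ^+ 2 / 2 = c / 2 * c by field.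
  have -> : r%:R * M%:R * (A * B) = M%:R * A * (B * r%:R) by ring.
  by apply: ler_pM; rewrite // ltW// divr_gt0.
have -> : c ^+ 2 / 2 = c * (c / 2) by field.
have -> : r%:R * M%:R * (A * B) = A * (r%:R * M%:R) * B by ring.
apply: ler_pM; rewrite ?(ltW c0) ?divr_ge0 ?(ltW c0)//; lra.
Qed.

(** Among four consecutive integers [P1] holds at most once and [P2] at most
    twice. *)
Lemma avoid_sparse (P1 P2 : pred nat) (n : nat) :
  (forall a j, (0 < j < 4)%N -> P1 a -> ~~ P1 (a + j)%N) ->
  (forall a, P2 a -> ~~ P2 a.+1) ->
  exists2 m, (n <= m)%N & ~~ P1 m && ~~ P2 m.
Proof.
move=> s1 s2; pose m a := ~~ P1 (n + a)%N && ~~ P2 (n + a)%N.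
suff : [|| m 0, m 1, m 2 | m 3]%N.
  by case/or4P; [exists (n + 0)%N|exists (n + 1)%N|exists (n + 2)%N|exists (n + 3)%N];
    rewrite // leq_addr.
have /implyP i01 := s1 n 1%N isT; have /implyP i02 := s1 n 2%N isT.
have /implyP i03 := s1 n 3%N isT; have /implyP i12 := s1 (n + 1)%N 1%N isT.
have /implyP i13 := s1 (n + 1)%N 2%N isT; have /implyP i23 := s1 (n + 2)%N 1%N isT.
have /implyP k01 := s2 n; have /implyP k12 := s2 (n + 1)%N.
have /implyP k23 := s2 (n + 2)%N.
move: i01 i02 i03 i12 i13 i23 k01 k12 k23.
rewrite -[in P2 n.+1]addn1 -!addnS -!addnA /m addn0.
by do 4!case: (P1 _); do 4!case: (P2 _).
Qed.

Section RationalPoints.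
Variable R : realType.
Implicit Types (t x y e : R).

Lemma nonint_gap t : (forall m : int, 6 * t <> m%:~R) ->
  exists2 c : R, 0 < c & forall j : nat, (0 < j < 4)%N -> 2 * c <= dist_int (j%:R * t).
Proof.
move=> ht.
have pos (j k : nat) : (j * k = 6)%N -> 0 < dist_int (j%:R * t).
  move=> jk; rewrite lt_neqAle dist_int_ge0 andbT eq_sym; apply/eqP.
  move=> /dist_int_eq0[m em]; apply: (ht (k%:Z * m)).
  by rewrite intrM -pmulrn -em mulrA -natrM mulnC jk.
have p1 := pos 1%N 6%N erefl; have p2 := pos 2%N 3%N erefl.
have p3 := pos 3%N 2%N erefl.
exists (Num.min (dist_int (1%:R * t))
   (Num.min (dist_int (2%:R * t)) (dist_int (3%:R * t))) / 2).
  by rewrite divr_gt0// !lt_min p1 p2 p3.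
move=> j; rewrite mulrCA divff// mulr1.
by case: j => [|[|[|[|]]]]// _; rewrite !ge_min lexx ?orbT.
Qed.

Lemma small_multiples_apart t s c (n j : nat) : 2 * c <= dist_int (j%:R * t) ->
  dist_int (n%:R * t - s) < c -> ~~ (dist_int ((n + j)%:R * t - s) < c).
Proof.
move=> h h1; apply/negP => h2.
have := dist_intB ((n + j)%:R * t - s) (n%:R * t - s).
have -> : (n + j)%:R * t - s - (n%:R * t - s) = j%:R * t by rewrite natrD; ring.
by lra.
Qed.

Lemma rational_gap t (n q : nat) (g : int) : (0 < n)%N ->
  dist_int (n%:R * t) / n%:R <= dist_int (q%:R * (g%:~R / n%:R) - t).
Proof.
move=> n0; have np : (0 : R) < n%:R by rewrite ltr0n.
rewrite ler_pdivrMr// [leRHS]mulrC -(dist_intN (n%:R * t)).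
rewrite -(dist_int_addz _ (q%:Z * g)); apply: le_trans (dist_int_natl _ _).
rewrite le_eqVlt; apply/orP; left; apply/eqP; congr dist_int.
by rewrite intrM -pmulrn; field; rewrite gt_eqF.
Qed.

Lemma rational_near x (n : nat) : (0 < n)%N ->
  exists g : int, `|g%:~R / n%:R - x| <= n%:R^-1.
Proof.
move=> n0; have np : (0 : R) < n%:R by rewrite ltr0n.
exists (Num.floor (n%:R * x)).
have h1 : (Num.floor (n%:R * x))%:~R <= n%:R * x by exact: floor_le_tmp.
have h2 : n%:R * x < (Num.floor (n%:R * x))%:~R + 1.
  by have := floorD1_gt (n%:R * x); rewrite intrD.
rewrite -(ler_pM2l np) -[X in X * `|_|](gtr0_norm np) -normrM mulrBr mulrCA.
by rewrite divff ?gt_eqF// mulr1 ler_norml; apply/andP; split; lra.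
Qed.

Lemma inv_nat_lt e : 0 < e -> exists n0 : nat, forall n, (n0 < n)%N -> n%:R^-1 < e.
Proof.
move=> e0; exists (Num.bound e^-1) => n hn.
have ie0 : 0 <= e^-1 by rewrite invr_ge0 ltW.
have h : e^-1 < n%:R.
  by apply: lt_trans (archi_boundP ie0) _; rewrite ltr_nat.
by rewrite -[e]invrK ltf_pV2 ?posrE ?invr_gt0// (lt_trans _ h) ?invr_gt0.
Qed.

(** The points [xi] with [M xi = zeta] modulo 1 are [1 / M]-dense. *)
Lemma lift_near x zeta (M : nat) : (0 < M)%N ->
  exists k : int, `|(zeta + k%:~R) / M%:R - x| <= M%:R^-1.
Proof.
move=> M0; have [k hk] := rational_near (x - zeta / M%:R) M0.
exists k; suff -> : (zeta + k%:~R) / M%:R - x =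
  k%:~R / M%:R - (x - zeta / M%:R) by [].
by ring.
Qed.

(** The conditions on [r], namely that [r theta1] and [r theta2] are not close to
    integers, each fail at most once in four consecutive integers, because the
    first three multiples of [theta1] and [theta2] are not integers.  The
    same holds for the condition on [M theta1 - theta2], whereas the one on
    [M r theta1] can only be said not to fail twice in a row. *)
Lemma has_dense_scales_nonint t1 t2 :
  (forall m : int, 6 * t1 <> m%:~R) -> (forall m : int, 6 * t2 <> m%:~R) ->
  has_dense_scales t1 t2.
Proof.
move=> /nonint_gap[c1 c10 h1] /nonint_gap[c2 c20 h2].
pose d := Num.min c1 c2; have d0 : 0 < d by rewrite lt_min c10.
have {}h1 j : (0 < j < 4)%N -> 2 * d <= dist_int (j%:R * t1).
  by move=> /h1; apply: le_trans; rewrite ler_pM2l// ge_min lexx.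
have {}h2 j : (0 < j < 4)%N -> 2 * d <= dist_int (j%:R * t2).
  by move=> /h2; apply: le_trans; rewrite ler_pM2l// ge_min lexx orbT.
(* halved since the second condition on M involves r * t1, for which only the
   bound d is known *)
pose c := d / 2; have c0 : 0 < c by rewrite divr_gt0.
exists (c ^+ 2 / 2); first by rewrite divr_gt0// exprn_gt0.
move=> x y e N e0; have [n0 hn0] := inv_nat_lt e0.
have [r nr] : exists2 r, ((n0 + N).+1 <= r)%N &
    ~~ (dist_int (r%:R * t1 - 0) < d) && ~~ (dist_int (r%:R * t2 - 0) < d).
  apply: (@avoid_sparse (fun r => dist_int (r%:R * t1 - 0) < d)
                        (fun r => dist_int (r%:R * t2 - 0) < d)).
    by move=> a j /h1; apply: small_multiples_apart.
  by move=> a; rewrite -addn1; apply: small_multiples_apart; exact: h2.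
rewrite !subr0 -!leNgt => /andP[r1 r2].
have [M nM] : exists2 M, ((n0 + N).+1 <= M)%N &
    ~~ (dist_int (M%:R * t1 - t2) < c) && ~~ (dist_int (M%:R * (r%:R * t1) - 0) < c).
  apply: (@avoid_sparse (fun M => dist_int (M%:R * t1 - t2) < c)
                        (fun M => dist_int (M%:R * (r%:R * t1) - 0) < c)).
    move=> a j /h1 hj; apply: small_multiples_apart; apply: le_trans hj.
    by rewrite /c; lra.
  move=> a; rewrite -addn1; apply: small_multiples_apart.
  by rewrite mul1r /c; lra.
rewrite subr0 -!leNgt => /andP[M1 M2].
have r0 : (0 < r)%N by apply: leq_ltn_trans nr.
have M0 : (0 < M)%N by apply: leq_ltn_trans nM.
have rp : (0 : R) < r%:R by rewrite ltr0n.
have Mp : (0 : R) < M%:R by rewrite ltr0n.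
have [g hg] := rational_near y r0.
have [k hk] := lift_near x (g%:~R / r%:R) M0.
exists ((g%:~R / r%:R + k%:~R) / M%:R), (g%:~R / r%:R), (r * M)%N; split.
- by rewrite (le_lt_trans hk)// hn0// (leq_trans _ nM)// ltnS leq_addr.
- by rewrite (le_lt_trans hg)// hn0// (leq_trans _ nr)// ltnS leq_addr.
- by rewrite (leq_trans _ (leq_pmulr _ M0))// (leq_trans _ nr)// ltnS leq_addl.
apply: (@resonant_lower_bound _ _ _ _ _ _ _ _ k) => //.
  by rewrite mulrCA divff ?gt_eqF// mulr1.
move=> q _; split.
  have -> : (g%:~R / r%:R + k%:~R) / M%:R = (g + r%:Z * k)%:~R / (r * M)%:R :> R.
    by rewrite intrD intrM -pmulrn natrM; field; rewrite !gt_eqF.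
  apply: le_trans (rational_gap _ _ _ _); last by rewrite muln_gt0 r0.
  by rewrite ler_pM2r ?invr_gt0 ?ltr0n ?muln_gt0 ?r0// natrM mulrAC mulrC.
apply: le_trans (rational_gap _ _ _ r0).
by rewrite ler_pM2r ?invr_gt0// (le_trans _ r2)// /c; lra.
Qed.

(** One of [r1] and [r2 = 2 r1 - 1] can serve as [r]: if [r1 theta2] is close
    to an integer, then [r2 theta2] is close to [- theta2] modulo 1. *)
Lemma has_dense_scales_0l t2 : (forall m : int, t2 <> m%:~R) -> has_dense_scales 0 t2.
Proof.
move=> ht; pose D := dist_int t2.
have D0 : 0 < D.
  rewrite lt_neqAle dist_int_ge0 andbT eq_sym; apply/eqP.
  by move=> /dist_int_eq0[m]; exact: ht.
pose c := Num.min 1 (D / 4); have c0 : 0 < c by rewrite lt_min ltr01 divr_gt0.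
have c1 : c <= 1 by rewrite ge_min lexx.
have cD : c <= D / 4 by rewrite ge_min lexx orbT.
exists (c ^+ 2 / 2); first by rewrite divr_gt0// exprn_gt0.
move=> x y e N e0; have [n0 hn0] := inv_nat_lt e0.
pose K := (n0 + N).+1; pose r j := (1 + K * K`! * j)%N.
have [j j0 hj] : exists2 j, (0 < j)%N & c <= dist_int ((r j)%:R * t2).
  have [h|h] := leP c (dist_int ((r 1)%:R * t2)); first by exists 1%N.
  exists 2%N => //.
  have := dist_intB (2%:R * ((r 1)%:R * t2)) ((r 2)%:R * t2).
  have -> : 2%:R * ((r 1)%:R * t2) - (r 2)%:R * t2 = t2.
    by rewrite /r !natrD !natrM; ring.
  by have := dist_int_natl 2 ((r 1)%:R * t2); rewrite -/D; lra.
have Kr : (K < r j)%N.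
  by rewrite /r ltnS -mulnA leq_pmulr// muln_gt0 fact_gt0.
have [g gr hg] := coprime_residue_near y (isT : (0 < K)%N) j0.
rewrite -/(r j) in hj Kr gr hg *; move: (r j) hj Kr gr hg => {}r hj Kr gr hg.
have r0 : (0 < r)%N by apply: leq_ltn_trans Kr.
have rp : (0 : R) < r%:R by rewrite ltr0n.
have [k hk] := lift_near x (g%:~R / r%:R) r0.
exists ((g%:~R / r%:R + k%:~R) / r%:R), (g%:~R / r%:R), (r * r)%N; split.
- by rewrite (le_lt_trans hk)// hn0// (leq_trans _ Kr)// !ltnS leqW// leq_addr.
- by rewrite (le_lt_trans hg)// hn0// ltnS leq_addr.
- by rewrite (leq_trans _ (leq_pmulr _ r0))// (leq_trans _ Kr)// !ltnS leqW// leq_addl.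
apply: (@resonant_lower_bound _ _ _ _ _ _ _ _ k) => //.
- by rewrite mulrCA divff ?gt_eqF// mulr1.
- by rewrite mulr0 sub0r dist_intN (le_trans cD)// ler_pdivrMr// ler_peMr ?ler1n ?ltW.
move=> q /andP[q0 qr]; split; last first.
  apply: le_trans (rational_gap _ _ _ r0).
  by rewrite ler_pM2r ?invr_gt0.
have -> : q%:R * ((g%:~R / r%:R + k%:~R) / r%:R) - 0 =
    (q%:Z * (r%:Z * k + g))%:~R / (r * r)%:R :> R.
  by rewrite intrM intrD intrM -!pmulrn natrM; field; rewrite !gt_eqF.
have rr0 : (0 < r * r)%N by rewrite muln_gt0 r0.
apply: le_trans (dist_int_small _ rr0 _).
  by rewrite ler_pdivrMr ?ltr0n// mulVf ?gt_eqF ?ltr0n.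
rewrite Gauss_dvdzl; last first.
  rewrite PoszM coprimezMl andbb /coprimez mulrC gcdzMDl gcdzC.
  exact: gr.
by rewrite dvdzE !absz_nat gtnNdvd.
Qed.
End RationalPoints.

(** * The homogeneous case *)

(** The numerators are [q s2 + s1] and [q (v + s2) + s1]: the digit [s2] is
    chosen with [s2 / q] near [x], then [v], coprime to [q], with [v / q] near
    [y - x], and the digit [s1], which moves both fractions by at most [1 / q],
    is determined by [B s1 = v] modulo [q]. *)
Lemma has_dense_scales_00 (R : realType) : has_dense_scales (0 : R) 0.
Proof.
exists (16^-1); first by rewrite invr_gt0.
move=> x y e N e0.
have [n0 hn0] : exists n0 : nat, forall n, (n0 < n)%N -> n%:R^-1 < e / 3.
  by apply: inv_nat_lt; rewrite divr_gt0.
pose K := (n0 + N).+2.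
have X1 : (1 < K * K`!)%N.
  by rewrite (@leq_trans K)// leq_pmulr// fact_gt0.
have [m mK mod1] := pell_mod K X1.
have /and3P[] := pell_bounds m.
have := pell_norm m; move: mod1.
case: (pell m) => q B /= mod1 pellE qm B0 B2q.
have q0 : (0 < q)%N by apply: leq_ltn_trans qm.
have [j j0 qE] : exists2 j, (0 < j)%N & q = (1 + K * K`! * j)%N.
  exists (q %/ (K * K`!))%N; last first.
    by rewrite {1}(divn_eq q (K * K`!)) mod1 modn_small// addnC mulnC.
  rewrite divn_gt0 ?(ltnW X1)// leqNgt; apply/negP => qX.
  by move: mod1; rewrite !modn_small// => q1; move: qm mK; rewrite q1; case: (m).
have [v vq hv] := coprime_residue_near (y - x) (isT : (0 < K)%N) j0.
rewrite -qE in vq hv.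
have qp : (0 : R) < q%:R by rewrite ltr0n.
have [s2 hs2] := rational_near x q0.
pose sg : int := B%:Z ^+ 2 - 2 * q%:Z ^+ 2.
have sg2 : sg * sg = 1.
  by rewrite -expr2 -[LHS]ger0_norm ?sqr_ge0// normrX pellE expr1n.
(* sg * B is the inverse of B modulo q, because B ^ 2 = sg modulo q *)
pose s1 := ((sg * B%:Z * v) %% q%:Z)%Z.
have q0z : q%:Z != 0 by rewrite -lt0n in q0 *; lia.
have s1_ge0 : 0 <= s1 := modz_ge0 _ q0z.
have s1_lt : s1 < q%:Z by have := ltz_mod (sg * B%:Z * v) q0z.
have cop : coprimez s1 q.
  rewrite /coprimez gcdz_modl -/(coprimez _ _) !coprimezMl vq andbT.
  apply/andP; split.
    apply/coprimezP; exists (sg, 0) => /=.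
    by rewrite sg2 mul0r addr0.
  apply/coprimezP; exists (sg * B%:Z, - (2 * sg * q%:Z)) => /=.
  by rewrite -[RHS]sg2 {3}/sg; ring.
have dvd : (q%:Z %| B%:Z * s1 - v)%Z.
  have sE : s1 = sg * B%:Z * v - (sg * B%:Z * v %/ q%:Z)%Z * q%:Z.
    by apply/eqP; rewrite eq_sym subr_eq [s1 + _]addrC -divz_eq.
  have e1 : B%:Z * (sg * B%:Z * v) - v = q%:Z * (2 * sg * q%:Z * v).
    transitivity (sg * (B%:Z ^+ 2 - 2 * q%:Z ^+ 2) * v - v + q%:Z * (2 * sg * q%:Z * v)).
      by ring.
    by rewrite -/sg sg2 mul1r subrr add0r.
  rewrite sE mulrBr addrAC e1; apply: rpredB; first exact/dvdz_mulr/dvdzz.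
  by rewrite mulrA; exact/dvdz_mull/dvdzz.
pose P : int := q%:Z * s2 + s1; pose T : int := q%:Z * (v + s2) + s1.
exists (P%:~R / (q ^ 2)%:R), (T%:~R / (q ^ 2)%:R), (q ^ 2)%N.
have Kq : (K < q)%N by apply: leq_ltn_trans qm.
have qi : q%:R^-1 < e / 3 :> R.
  by apply: hn0; rewrite (leq_trans _ Kq)// !ltnS leqW// leqW// leq_addr.
have Ki : K%:R^-1 < e / 3 :> R by apply: hn0; rewrite !ltnS leqW// leq_addr.
have q2p : (0 : R) < (q ^ 2)%:R by rewrite ltr0n expn_gt0 q0.
pose d : R := s1%:~R / (q ^ 2)%:R.
have s1q : 0 <= d <= q%:R^-1.
  rewrite /d divr_ge0 ?ler0z//= ler_pdivrMr// natrX expr2 mulrA mulVf ?gt_eqF// mul1r.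
  by rewrite pmulrn ler_int ltW.
split.
- have -> : P%:~R / (q ^ 2)%:R = s2%:~R / q%:R + d :> R.
    by rewrite /d intrD intrM -pmulrn natrX; field; rewrite gt_eqF.
  move: hs2 s1q; rewrite ler_norml ltr_norml => /andP[? ?] /andP[? ?].
  by apply/andP; split; lra.
- have -> : T%:~R / (q ^ 2)%:R =
      v%:~R / q%:R + s2%:~R / q%:R + d :> R.
    by rewrite /d !intrD !intrM !intrD -pmulrn natrX; field; rewrite gt_eqF.
  move: hs2 s1q hv; rewrite !ler_norml ltr_norml => /andP[? ?] /andP[? ?] /andP[? ?].
  by apply/andP; split; lra.
- rewrite expnS expn1 (leq_trans _ (leq_pmulr _ q0))//.
  by rewrite (leq_trans _ Kq)// !ltnS leqW// leqW// leq_addl.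
move=> a aq; rewrite !subr0.
have [m1 ->] := dist_int_ex (a%:R * (P%:~R / (q ^ 2)%:R) : R).
have [m2 ->] := dist_int_ex (a%:R * (T%:~R / (q ^ 2)%:R) : R).
have num (U k : int) : `|a%:R * (U%:~R / (q ^ 2)%:R) - k%:~R| =
    `|a%:Z * U - q%:Z ^+ 2 * k|%:~R / (q ^ 2)%:R :> R.
  rewrite intr_norm -[X in _ = _ / X](gtr0_norm q2p) -normf_div; congr `|_|.
  by rewrite intrB !intrM -!pmulrn natrX; field; rewrite gt_eqF.
rewrite !num.
have : q%:Z ^+ 2 <= 16 * (`|a%:Z * P - q%:Z ^+ 2 * m1| * `|a%:Z * T - q%:Z ^+ 2 * m2|).
  exact: (@folded_lattice_bound q%:Z B%:Z s1 s2 v a%:Z m1 m2 _ _ _ pellE cop dvd).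
move: `|_ - _ * m1| `|_ - _ * m2| => A C; rewrite -(ler_int R) !intrM -!pmulrn => h.
have -> : (q ^ 2)%:R * (A%:~R / (q ^ 2)%:R * (C%:~R / (q ^ 2)%:R)) =
    A%:~R * C%:~R / (q ^ 2)%:R :> R by field; rewrite gt_eqF.
rewrite ler_pdivlMr// mulrC ler_pdivrMr ?ltr0n// natrX.
by rewrite [leRHS]mulrC; move: h; rewrite expr2.
Qed.

(** * Completeness of the plane and Baire category *)

(** Baire's theorem is used in [R * R], which therefore has to be endowed with its
    structure of complete normed module.  The next command forms the joins of
    the pointed structure of products with their topological ones, on which
    completeness depends. *)
HB.saturate prod.

Lemma prod_cauchy_cvg (T1 T2 : completeType) (F : set_system (T1 * T2)) :
  ProperFilter F -> cauchy F -> cvg F.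
Proof.
move=> FF cF.
have c1 : cvg (fst @ F).
  apply: cauchy_cvg => A /= eA; rewrite near_simpl -near2E near_map2.
  apply: cF; exists (A, setT); first by split => //=; exact: entourageT.
  by move=> [[a b] [c d]] [/= Aab _]; exists ((a, c), (b, d)).
have c2 : cvg (snd @ F).
  apply: cauchy_cvg => A /= eA; rewrite near_simpl -near2E near_map2.
  apply: cF; exists (setT, A); first by split => //=; exact: entourageT.
  by move=> [[a b] [c d]] [/= _ Acd]; exists ((a, c), (b, d)).
apply/cvg_ex; exists (lim (fst @ F), lim (snd @ F)) => A.
have /(_ _ _ _)/= h := cvg_pair c1 c2.
by move=> /h; rewrite !nbhs_simpl; apply: (@filterS _ F) => -[].
Qed.

HB.instance Definition _ (K : realType) (U V : completeNormedModType K) :=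
  Uniform_isComplete.Build (U * V)%type (@prod_cauchy_cvg U V).

Section Topology.
Variable R : realType.
Implicit Types (t x y : R) (p : R * R).

Lemma continuous_dist_int : continuous (@dist_int R).
Proof.
move=> x; apply/cvgrPdist_lt => e e0.
apply: filterS (nbhsx_ballx x e e0) => y; rewrite -ball_normE /=.
exact: le_lt_trans (dist_int_lip _ _).
Qed.

Definition scale_prod t1 t2 (S q : nat) p : R :=
  S%:R * (dist_int (q%:R * p.1 - t1) * dist_int (q%:R * p.2 - t2)).

Lemma continuous_scale_prod t1 t2 S q : continuous (scale_prod t1 t2 S q).
Proof.
have c1 t n (f : R * R -> R) : continuous f ->
    continuous (fun p => dist_int (n%:R * f p - t)).
  move=> cf p; apply: (@continuous_comp _ _ _ (fun p => n%:R * f p - t));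
    last exact: continuous_dist_int.
  by apply: cvgB; [apply: cvgM; [exact: cvg_cst|exact: cf]|exact: cvg_cst].
move=> p; apply: cvgM; first exact: cvg_cst.
apply: cvgM; apply: c1 => z; [exact: cvg_fst|exact: cvg_snd].
Qed.

(** The inequality is strict so that this set is open. *)
Definition good_at t1 t2 c (S : nat) : set (R * R) :=
  [set p | forall q, (0 < q < S)%N -> c < scale_prod t1 t2 S q p].

Lemma open_good_at t1 t2 c S : open (good_at t1 t2 c S).
Proof.
(* induction on the range of q, with the scale S fixed *)
suff h n : open [set p | forall q, (0 < q < n)%N ->
  c < scale_prod t1 t2 S q p] by exact: h.
elim: n => [|n ih].
  rewrite (_ : mkset _ = setT); first exact: openT.
  by apply/seteqP; split => // p _ q; rewrite ltn0 andbF.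
have [->|n0] := posnP n.
  rewrite (_ : mkset _ = setT); first exact: openT.
  by apply/seteqP; split => // p _ [|q].
rewrite (_ : mkset _ =
    [set p | forall q, (0 < q < n)%N -> c < scale_prod t1 t2 S q p]
    `&` (scale_prod t1 t2 S n @^-1` [set z | c < z])); last first.
  apply/seteqP; split => p.
    move=> h; split; last by apply: h; rewrite n0 ltnSn.
    by move=> q /andP[q0 qn]; apply: h; rewrite q0 ltnS ltnW.
  move=> [h hn] q /andP[q0]; rewrite ltnS leq_eqVlt => /predU1P[->//|qn].
  by apply: h; rewrite q0.
apply: openI ih _; apply: open_comp; last exact: open_gt.
by move=> p _; exact: continuous_scale_prod.
Qed.

(** Passing from [S] to [Q = S - 1 >= S / 2] costs a factor 2. *)
Lemma good_at_Theta t1 t2 c p : 0 < c ->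
  (forall n, exists2 S, (n < S)%N & good_at t1 t2 c S p) -> Theta t1 t2 p.
Proof.
move=> c0 h; rewrite /Theta /= limn_esup_lim.
apply: (@lt_le_trans _ _ (c / 2)%:E); first by rewrite lte_fin divr_gt0.
apply: lime_ge; first exact: is_cvg_esups.
apply: nearW => n.
(* a scale S.+2 > n.+1 gives Q = S.+1, that is the term of index S >= n *)
have [[//|[//|S]] nS hS] := h n.+1.
apply: ereal_sup_ge.
exists (S.+1%:R%:E * min_prod t1 t2 p.1 p.2 S.+1)%E.
  by exists S => //=; rewrite -ltnS -ltnS.
have Sp : (0 : R) < S.+1%:R by [].
suff : ((c / 2 / S.+1%:R)%:E <= min_prod t1 t2 p.1 p.2 S.+1)%E.
  move=> le; rewrite (_ : (c / 2)%:E = S.+1%:R%:E * (c / 2 / S.+1%:R)%:E)%E.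
    by rewrite lee_pmul2l// lte_fin.
  by rewrite -EFinM mulrCA divff ?gt_eqF// mulr1.
rewrite /min_prod big_nat.
apply: (big_ind (fun z => ((c / 2 / S.+1%:R)%:E <= z)%E)) => [|a b ha hb|q hq].
- by rewrite leey.
- by rewrite le_min ha.
rewrite lee_fin ler_pdivrMr//.
have := hS q hq; rewrite /scale_prod.
set P := dist_int _ * _ => hP.
have P0 : 0 <= P by rewrite mulr_ge0 ?dist_int_ge0.
have : S.+2%:R <= 2 * S.+1%:R :> R.
  by rewrite -natrM ler_nat mul2n -addnn addnS ltnS leq_addr.
move: hP; nra.
Qed.

Lemma dense_Gdelta_Theta t1 t2 : has_dense_scales t1 t2 ->
  exists G : set (R * R), [/\ Gdelta G, dense G & G `<=` Theta t1 t2].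
Proof.
move=> [c c0 h].
pose F n := \bigcup_(S in [set S | (n < S)%N]) good_at t1 t2 (c / 2) S.
have oF n : open (F n) by apply: bigcup_open => S _; exact: open_good_at.
exists (\bigcap_n F n); split.
- by exists F.
- apply: Baire => n; split => //; move=> D [p Dp] oD.
  have /nbhs_ballP[e /= e0 eD] : nbhs p D by exact: open_nbhs_nbhs.
  have [xi [zeta [S [h1 h2 h3 h4]]]] := h p.1 p.2 e n e0.
  exists (xi, zeta); split.
    by apply: eD; split; rewrite -ball_normE /= distrC.
  exists S => // q hq; apply: lt_le_trans (h4 q hq).
  by rewrite ltr_pdivrMr// ltr_pMr// ltr1n.
- move=> p Gp; apply: (@good_at_Theta t1 t2 (c / 2)); first by rewrite divr_gt0.
  by move=> n; have [S nS gS] := Gp n I; exists S.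
Qed.

End Topology.

(** * Conclusion *)

Lemma has_dense_scales_all (R : realType) (t1 t2 : R) : has_dense_scales t1 t2.
Proof.
(* scaling by 6 turns a into an integer, then into 0 *)
have red (a b : R) (m : int) : 6 * a = m%:~R -> has_dense_scales a b.
  move=> am; apply: (@has_dense_scales_natl _ 6) => //; rewrite am.
  apply: has_dense_scales_int.
  have [[k ->]|nk] := pselect (exists k : int, 6%:R * b = k%:~R).
    by apply/has_dense_scales_sym/has_dense_scales_int/has_dense_scales_00.
  by apply: has_dense_scales_0l => k ek; apply: nk; exists k.
have [[m /red//]|n1] := pselect (exists m : int, 6 * t1 = m%:~R).
have [[m mE]|n2] := pselect (exists m : int, 6 * t2 = m%:~R).
  by apply: has_dense_scales_sym; exact: red mE.
apply: has_dense_scales_nonint => m em; [apply: n1|apply: n2]; by exists m.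
Qed.

Theorem theorem1p2 (R : realType) (theta1 theta2 : R) :
  exists G : set (R * R), [/\ Gdelta G, dense G & G `<=` Theta theta1 theta2].
Proof. exact/dense_Gdelta_Theta/has_dense_scales_all. Qed.
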